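(* Assume the MDS Conjecture holds. Let $C$ be an $[n,k]$ code over $\mathbb{F}_q$ with $C^\perp\neq\{\bm 0\}$, $d^\perp:=d(C^\perp)\ge 3$ and $d^\perp\neq q$. If $C$ is monomially equivalent to a dual Hamming code, or if $q=2$, $k=n-1$ and $d^\perp=n$ is odd, then $\gamma(C)=k-d^\perp+3$. Otherwise $\gamma(C)\le k-d^\perp+2$.
   Context: An $[n,k]$ code over $\mathbb{F}_q$ is a $k$-dimensional subspace $C\subseteq\mathbb{F}_q^n$; write $E=\{1,\dots,n\}$. For $\bm{x}\in\mathbb{F}_q^n$, $\mathrm{supp}(\bm{x})=\{i: x_i\neq 0\}$ and the weight is $|\mathrm{supp}(\bm{x})|$; for $B\subseteq\mathbb{F}_q^n$, $\mathrm{Supp}(B)=\bigcup_{\bm{x}\in B}\mathrm{supp}(\bm{x})$. $C^\perp$ is the dual code with respect to the standard inner product and $d(C^\perp)$ is the minimum weight of a nonzero codeword of $C^\perp$. The covering dimension is $\gamma(C)=\infty$ if $\mathrm{Supp}(C)\neq E$, and otherwise $\gamma(C)$ is the least positive integer $r$ such that $C$ has an $r$-dimensional subspace $D$ with $\mathrm{Supp}(D)=E$. A dual Hamming code is an $[(q^k-1)/(q-1),k]$ code over $\mathbb{F}_q$ with a generator matrix whose columns consist of exactly one nonzero vector from each one-dimensional subspace of $\mathbb{F}_q^k$. Two codes are monomially equivalent if one is obtained from the other by permuting coordinates and multiplying coordinates by nonzero scalars. An MDS code is an $[n,k]$ code with minimum weight $n-k+1$; it is nontrivial if $2\le k\le n-2$.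 The MDS Conjecture asserts: for every prime power $q$, if there is a nontrivial $[n,k]$ MDS code over $\mathbb{F}_q$, then $n\le q+1$, except when $q$ is even and $k=3$ or $k=q-1$, in which case $n\le q+2$. *)

(* Defs.v *)
From HB Require Import structures.
From mathcomp Require Import all_boot all_order all_algebra all_fingroup all_field.
Set Implicit Arguments. Unset Strict Implicit. Unset Printing Implicit Defensive.
Import GRing.Theory.
Local Open Scope ring_scope.

Section Codes.
Variables (F : finFieldType) (n : nat).

Definition supp (x : 'rV[F]_n) : {set 'I_n} := [set i | x 0 i != 0].
Definition wt (x : 'rV[F]_n) : nat := #|supp x|.

Definition Supp (C : {vspace 'rV[F]_n}) : {set 'I_n} :=
  [set i | [exists x : 'rV[F]_n, (x \in C) && (x 0 i != 0)]].

Definition dotp (x y : 'rV[F]_n) : F := \sum_i x 0 i * y 0 i.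
Definition in_dual (C : {vspace 'rV[F]_n}) (y : 'rV[F]_n) : Prop :=
  forall x, x \in C -> dotp x y = 0.

Definition minwt_is (P : 'rV[F]_n -> Prop) (d : nat) : Prop :=
  (exists x, [/\ P x, x != 0 & wt x = d]) /\
  (forall x, P x -> x != 0 -> (d <= wt x)%N).

Definition covdim_is (C : {vspace 'rV[F]_n}) (r : nat) : Prop :=
  [/\ Supp C = setT, (0 < r)%N,
      (exists D : {vspace 'rV[F]_n}, [/\ (D <= C)%VS, \dim D = r & Supp D = setT])
    & (forall D : {vspace 'rV[F]_n}, (D <= C)%VS -> (0 < \dim D)%N ->
         Supp D = setT -> (r <= \dim D)%N)].

Definition monomial_map (s : 'S_n) (a : 'I_n -> F) (x : 'rV[F]_n) : 'rV[F]_n :=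
  \row_i (a i * x 0 (s i)).

Definition mon_equiv (C D : {vspace 'rV[F]_n}) : Prop :=
  exists (s : 'S_n) (a : 'I_n -> F), (forall i, a i != 0) /\
    (forall y, y \in D <-> exists2 x, x \in C & y = monomial_map s a x).

(* dual Hamming code: an [(q^k-1)/(q-1), k] code with a generator matrix whose
   columns consist of exactly one nonzero vector from each 1-dim subspace of F^k *)
Definition dual_hamming (D : {vspace 'rV[F]_n}) : Prop :=
  exists (k : nat) (G : 'M[F]_(k, n)),
    [/\ n = ((#|F| ^ k - 1) %/ (#|F| - 1))%N,
        \dim D = k,
        (forall y, y \in D <-> exists u : 'rV[F]_k, y = u *m G),
        (forall j, col j G != 0)
      & (forall v : 'cV[F]_k, v != 0 ->
           exists j, (exists c : F, col j G = c *: v) /\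
             forall j', (exists c : F, col j' G = c *: v) -> j' = j)].

End Codes.

Definition is_MDS (F : finFieldType) (n : nat) (C : {vspace 'rV[F]_n}) : Prop :=
  minwt_is (fun x => x \in C) (n - \dim C + 1)%N.

Definition MDS_conjecture : Prop :=
  forall (F : finFieldType) (n k : nat) (C : {vspace 'rV[F]_n}),
    \dim C = k -> (2 <= k <= n - 2)%N -> is_MDS C ->
    if ~~ odd #|F| && ((k == 3) || (k == #|F| - 1))%N
    then (n <= #|F| + 2)%N else (n <= #|F| + 1)%N.

(* Main.v *)
Require Import Defs.
From HB Require Import structures.
From mathcomp Require Import all_boot all_order all_algebra all_fingroup all_field.
From mathcomp Require Import zify.
From Stdlib Require Import Classical_Prop.

(**
For a set S of coordinates let Z be the subcode of the words of C vanishing on S, and let M be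
the complement of Supp Z (the closure of S in the matroid of C). If |S| < d then C restricts onto
F^S, so Z has dimension k - |S|; if moreover some x in C has no zero on M, then Z + <x> has
dimension k - |S| + 1 and full support. With |S| = d - 2 we have M = S, which gives the
bound k - d + 3.

For d >= 4 take |S| = d - 1. If |M| <= |S| + 1, the word x is written down from the dual word
supported on M (unique up to scalars, if any), except when q = 2 and d is odd,
where S must first be chosen with M = S. Otherwise the restriction of C to M is a nontrivial MDS code of dimension d - 1, so the
MDS conjecture and d <> q leave |M| <= q + 1, or |M| = q + 2 with d = 4. Passing to a
subcode on which one, respectively two, pairs of coordinates become proportional leaves at most q
independent coordinates, and q hyperplanes do not cover a vector space.

For d = 3, C has a hyperplane of full support exactly when some point of PG(k - 1, q) is not a
column of the generator matrix.
*)

Set Implicit Arguments. Unset Strict Implicit. Unset Printing Implicit Defensive.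
Import GRing.Theory.

(** * Inner products and annihilators *)

Section WordsAndDuals.
Local Open Scope ring_scope.
Variables (F : finFieldType) (n : nat).
Implicit Types (C V : {vspace 'rV[F]_n}).

Lemma dim_rV : \dim {:'rV[F]_n} = n.
Proof. by rewrite dimvf /dim /= mul1n. Qed.

Lemma dotpDl (x y z : 'rV[F]_n) : dotp (x + y) z = dotp x z + dotp y z.
Proof.
by rewrite /dotp -big_split /=; apply: eq_bigr => i _; rewrite !mxE mulrDl.
Qed.

Lemma dotpZl c (x z : 'rV[F]_n) : dotp (c *: x) z = c * dotp x z.
Proof.
by rewrite /dotp mulr_sumr; apply: eq_bigr => i _; rewrite !mxE mulrA.
Qed.

Lemma dotpC (x y : 'rV[F]_n) : dotp x y = dotp y x.
Proof. by apply: eq_bigr => i _; rewrite mulrC. Qed.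

Lemma dotp_delta (x : 'rV[F]_n) i : dotp (delta_mx 0 i) x = x 0 i.
Proof.
rewrite /dotp (bigD1 i) //= big1 ?addr0 => [|j ji]; first by rewrite mxE !eqxx mul1r.
by rewrite mxE (negPf ji) andbF mul0r.
Qed.

Definition annih (C : {vspace 'rV[F]_n}) (y : 'rV[F]_n) : {vspace 'rV[F]_n} :=
  (C :&: lker (linfun (mulmxr y^T)))%VS.

Lemma annihP C y x : reflect (x \in C /\ dotp x y = 0) (x \in annih C y).
Proof.
rewrite memv_cap memv_ker lfunE /= [x *m _]mx11_scalar fmorph_eq0.
have -> : (x *m y^T) 0 0 = dotp x y by rewrite mxE; apply: eq_bigr => i _; rewrite mxE.
by apply: (iffP andP) => -[? /eqP].
Qed.

(** A basis of [V] imposes fewer than n linear equations on z, so they have a nonzero solution. *)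
Lemma dim_lt_dual V : (\dim V < n)%N ->
  exists2 z, z != 0 & in_dual V z.
Proof.
move=> ltVn; pose G := \matrix_(i < \dim V) (vbasis V)`_i.
have kG0 : kermx G^T != 0.
  rewrite -mxrank_eq0 mxrank_ker -lt0n subn_gt0.
  by apply: leq_ltn_trans (rank_leq_col _) ltVn.
exists (nz_row (kermx G^T)); first by rewrite nz_row_eq0.
move=> x xV; rewrite (coord_vbasis xV).
have /sub_kermxP zG := nz_row_sub (kermx G^T).
elim/big_ind: _ => [|y z y0 z0|i _].
- by rewrite /dotp big1 // => i _; rewrite mxE mul0r.
- by rewrite dotpDl y0 z0 addr0.
rewrite dotpZl; suff -> : dotp (vbasis V)`_i (nz_row (kermx G^T)) = 0 by rewrite mulr0.
have := congr1 (fun M : 'rV_(\dim V) => M 0 i) zG; rewrite !mxE => <-.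
by apply: eq_bigr => j _; rewrite !mxE mulrC.
Qed.

End WordsAndDuals.

(** * Restriction to a set of coordinates, and shortening *)

Section Shortening.
Local Open Scope ring_scope.
Variables (F : finFieldType) (n : nat).
Implicit Types (C D : {vspace 'rV[F]_n}) (S T J M : {set 'I_n}).

(** Coordinates are renumbered through [enum_val], so that images are codes of length [#|S|] in
    their own right, as the MDS conjecture requires. *)
Definition restr S : 'Hom('rV[F]_n, 'rV[F]_#|S|) :=
  linfun (colsub (fun j : 'I_#|S| => enum_val j)).

Lemma restrE S x j : restr S x 0 j = x 0 (enum_val j).
Proof. by rewrite lfunE /= mxE. Qed.

Lemma extend_by_zero S (w : 'rV[F]_#|S|) : exists2 v : 'rV[F]_n,
  forall j, v 0 (enum_val j) = w 0 j & supp v \subset S.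
Proof.
(* The sum has exactly one term when i lies in [S] and is empty otherwise. *)
exists (\row_i \sum_(j | enum_val j == i) w 0 j) => [j|].
  rewrite mxE (eq_bigl (pred1 j)) ?big_pred1_eq // => k /=.
  by rewrite (inj_eq enum_val_inj).
apply/subsetP=> i; rewrite inE mxE; apply: contraR => iS.
by rewrite big1 // => j /eqP ji; rewrite -ji enum_valP in iS.
Qed.

(** The shortened code of coding theory, kept at length n with zeros on [S]. *)
Definition shorten C S : {vspace 'rV[F]_n} := (C :&: lker (restr S))%VS.

Lemma shortenP C S x :
  reflect (x \in C /\ {in S, forall i, x 0 i = 0}) (x \in shorten C S).
Proof.
rewrite memv_cap memv_ker; apply: (iffP andP) => -[xC].
  move/eqP/rowP=> x0; split=> // i iS; have := x0 (enum_rank_in iS i).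
  by rewrite restrE enum_rankK_in // mxE.
move=> x0; split=> //; apply/eqP/rowP=> j.
by rewrite restrE mxE x0 // enum_valP.
Qed.

(** Independence of [S] in the matroid of [C]. *)
Definition free_on C S := forall v : 'rV[F]_n,
  exists2 x, x \in C & {in S, forall i, x 0 i = v 0 i}.

Lemma free_onP C S : reflect (free_on C S) (restr S @: C == fullv)%VS.
Proof.
apply: (iffP eqP) => [full v|freeS].
  have : restr S v \in (restr S @: C)%VS by rewrite full memvf.
  case/memv_imgP=> x xC /rowP vx; exists x => // i iS.
  by have := vx (enum_rank_in iS i); rewrite !restrE enum_rankK_in.
apply/vspaceP=> w; rewrite memvf; apply/memv_imgP.
have [v vw _] := extend_by_zero w; have [x xC xv] := freeS v.
by exists x => //; apply/rowP=> j; rewrite restrE xv ?enum_valP // vw.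
Qed.

(** A proper subspace of F^S has a nonzero orthogonal vector, and its extension by zero is
    orthogonal to [C]. *)
Lemma not_free_dual C S : ~~ (restr S @: C == fullv)%VS ->
  exists y, [/\ in_dual C y, y != 0 & supp y \subset S].
Proof.
move=> nfull; have [z z0 dz] : exists2 z, z != 0 & in_dual (restr S @: C)%VS z.
  apply: dim_lt_dual; rewrite ltn_neqAle; apply/andP; split; last first.
    by apply: leq_trans (dimvS (subvf _)) _; rewrite dimvf /dim /= mul1n.
  apply: contra nfull => /eqP dimE; rewrite eqEdim subvf.
  by rewrite dimvf /dim /= mul1n dimE.
have [y yz yS] := extend_by_zero z; exists y; split=> // [x xC|].
  have <- := dz _ (memv_img (restr S) xC).
  rewrite /dotp (bigID (mem S)) /= [X in _ + X]big1 ?addr0 => [|i iS].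
    by rewrite big_enum_val; apply: eq_bigr => j _; rewrite restrE yz.
  have /eqP-> : y 0 i == 0; last by rewrite mulr0.
  by apply: contraR iS => y0; apply: (subsetP yS); rewrite inE.
by apply: contraNneq z0 => y0; apply/eqP/rowP=> j; rewrite -yz y0 !mxE.
Qed.

Lemma SuppP D i : reflect (exists2 x, x \in D & x 0 i != 0) (i \in Supp D).
Proof.
rewrite inE; apply: (iffP existsP) => [[x /andP[]]|[x xD xi]]; first by exists x.
by exists x; rewrite xD.
Qed.

Lemma dim_shorten C S : free_on C S -> (\dim (shorten C S) + #|S|)%N = \dim C.
Proof.
move/free_onP/eqP=> full; rewrite -(limg_ker_dim (restr S) C) full dim_rV.
by [].
Qed.

Lemma shorten_Supp C S i x : i \notin Supp (shorten C S) ->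
  x \in shorten C S -> x 0 i = 0.
Proof. by move=> iZ xZ; apply: contraNeq iZ => xi; apply/SuppP; exists x. Qed.

Lemma notin_Supp_shorten C S i : i \in S -> i \notin Supp (shorten C S).
Proof.
by move=> iS; apply/SuppP=> -[x /shortenP[_ x0]]; rewrite x0 // eqxx.
Qed.

(** The subcode is Z + <x> with Z = [shorten C S]. As Z vanishes on the nonempty set [S] and x does
    not, x lies outside Z. *)
Lemma full_extension C S x : free_on C S -> (0 < #|S|)%N -> x \in C ->
    (forall i, i \notin Supp (shorten C S) -> x 0 i != 0) ->
  exists D : {vspace 'rV[F]_n},
    [/\ (D <= C)%VS, (\dim D + #|S|)%N = (\dim C).+1 & Supp D = setT].
Proof.
move=> freeS /card_gt0P[i0 i0S] xC xfull; set Z := shorten C S in xfull.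
have xi0 := xfull _ (notin_Supp_shorten C i0S).
have xZ : x \notin Z.
  by apply: contra xi0 => xZ; rewrite (shorten_Supp (notin_Supp_shorten C i0S) xZ).
exists (Z + <[x]>)%VS; split.
- by rewrite subv_add capvSl -memvE.
- rewrite dimv_disjoint_sum ?dim_vline.
    have -> : x != 0 by apply: contraNneq xi0 => ->; rewrite mxE.
    by rewrite addn1 addSn dim_shorten.
  apply/eqP; rewrite -subv0; apply/subvP=> y /memv_capP[yZ /vlineP[c yE]].
  rewrite yE in yZ *; have [->|c0] := eqVneq c 0; first by rewrite scale0r mem0v.
  by case/negP: xZ; rewrite -[x](scalerK c0) memvZ.
apply/setP=> i; rewrite in_setT; apply/SuppP.
have [/SuppP[y yZ yi]|iZ] := boolP (i \in Supp Z).
  by exists y => //; apply: subvP (addvSl _ _) _ yZ.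
by exists x; [apply: subvP (addvSr _ _) _ (memv_line x) | apply: xfull].
Qed.

(** Induction on [#|J|]. If x has no zero on J except at j, and y is nonzero at j, then y + c x
    works once c avoids the values - y_i / x_i, of which there are at most [#|J|] - 1 < q. *)
Lemma nonvanishing_word D J : (#|J| <= #|F|)%N -> J \subset Supp D ->
  exists2 x, x \in D & {in J, forall i, x 0 i != 0}.
Proof.
have [m] := ubnP #|J|; elim: m J => // m IH J ltJm leJq JD.
have [->|[j jJ]] := set_0Vmem J; first by exists 0; rewrite ?mem0v // => i; rewrite inE.
have cardJ := cardsD1 j J; rewrite jJ add1n in cardJ.
have [] := IH (J :\ j).
- by rewrite -ltnS -cardJ.
- by apply: leq_trans leJq; rewrite cardJ.
- by apply: subset_trans JD; apply: subsetDl.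
move=> x xD xJ; have [xj|xj] := eqVneq (x 0 j) 0; last first.
  exists x => // i iJ; have [->//|ij] := eqVneq i j.
  by apply: xJ; rewrite !inE ij.
have /SuppP[y yD yj] := subsetP JD _ jJ.
pose bad := [set - (y 0 i / x 0 i) | i in J :\ j].
have /card_gt0P[c] : (0 < #|~: bad|)%N.
  rewrite cardsCs setCK subn_gt0 (leq_ltn_trans (leq_imset_card _ _)) //.
  by rewrite -cardJ.
rewrite inE => cbad; exists (y + c *: x); first by rewrite memvD ?memvZ.
move=> i iJ; rewrite !mxE; have [->|ij] := eqVneq i j.
  by rewrite xj mulr0 addr0.
have iJ' : i \in J :\ j by rewrite !inE ij.
apply: contra cbad; rewrite addrC addr_eq0 => /eqP cx; apply/imsetP; exists i => //.
by rewrite -mulNr -cx mulfK ?xJ.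
Qed.

(** * Codes whose nonzero dual words have weight at least d *)

Section MinimumDistance.
Variables (C : {vspace 'rV[F]_n}) (d : nat).
Hypothesis dual_wt : forall y, in_dual C y -> y != 0 -> (d <= wt y)%N.

Lemma small_free S : (#|S| < d)%N -> free_on C S.
Proof.
move=> ltSd; apply/free_onP; apply: contraLR ltSd => /not_free_dual[y [dy y0 yS]].
by rewrite -leqNgt (leq_trans (dual_wt dy y0)) // subset_leq_card.
Qed.

(** No word of [C] vanishes on [S] and is nonzero at e, so e |: S is not free and contains the
    support of a nonzero dual word. Its weight is at least d = [#|S|] + 1, which forces equality. *)
Lemma dual_circuit S e : #|S|.+1 = d -> e \notin S ->
  e \notin Supp (shorten C S) -> exists2 y, in_dual C y & supp y = e |: S.
Proof.
move=> cardS eS eZ; have [y [dy y0 ysub]] : exists y,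
    [/\ in_dual C y, y != 0 & supp y \subset e |: S].
  apply: not_free_dual; apply: contra eZ => /free_onP/(_ (delta_mx 0 e))[x xC xE].
  apply/SuppP; exists x; last first.
    by rewrite xE ?setU11 // mxE !eqxx oner_eq0.
  apply/shortenP; split=> // i iS; rewrite xE ?setU1r // mxE eqxx.
  by case: eqP => // ie; rewrite -ie iS in eS.
exists y => //; apply/eqP; rewrite eqEcard ysub cardsU1 eS add1n cardS.
exact: dual_wt.
Qed.

Lemma dual_eval x y S e : in_dual C y -> supp y = e |: S -> e \notin S ->
  x \in C -> x 0 e * y 0 e = - \sum_(i in S) x 0 i * y 0 i.
Proof.
move=> dy ySupp eS xC; apply/eqP; rewrite -addr_eq0; apply/eqP.
rewrite -[RHS](dy x xC) /dotp [RHS](bigID (mem (supp y))) /= ySupp big_setU1 //=.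
rewrite [X in _ = _ + X]big1 ?addr0 // => i; rewrite -ySupp inE negbK => /eqP->.
by rewrite mulr0.
Qed.

(** With g_i the columns of a generator matrix, these are the words whose linear form vanishes at
    the point a g_i1 + b g_i2 of a secant. For nonzero a, b the entries at i1 and i2 are
    proportional. *)
Definition pencil i1 i2 (a b : F) : {vspace 'rV[F]_n} :=
  annih C (a *: delta_mx 0 i1 + b *: delta_mx 0 i2).

Lemma pencilP i1 i2 a b x :
  reflect (x \in C /\ a * x 0 i1 + b * x 0 i2 = 0) (x \in pencil i1 i2 a b).
Proof.
have <- : dotp x (a *: delta_mx 0 i1 + b *: delta_mx 0 i2) = a * x 0 i1 + b * x 0 i2.
  by rewrite dotpC dotpDl !dotpZl !dotp_delta.
exact: annihP.
Qed.

(** Any three coordinates are free. Entries b and -a at i1 and i2 cover these two; entries 0, 0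
    there and 1 at i cover a third coordinate i. *)
Lemma Supp_pencil i1 i2 a b : (3 < d)%N -> i1 != i2 -> a != 0 -> b != 0 ->
  Supp (pencil i1 i2 a b) = setT.
Proof.
move=> d4 i12 a0 b0; apply/setP=> i; rewrite in_setT; apply/SuppP.
have free3 j : free_on C [set i1; i2; j].
  apply: small_free; apply: leq_ltn_trans d4; rewrite setUC cardsU1 cards2 i12.
  by case: (j \notin _).
have [|] := boolP (i \in [set i1; i2]) => i_in.
  have [x xC xE] := free3 i1 (b *: delta_mx 0 i1 - a *: delta_mx 0 i2).
  have x1 : x 0 i1 = b.
    by rewrite xE ?inE ?eqxx // !mxE !eqxx (negPf i12) /= mulr1 mulr0 subr0.
  have x2 : x 0 i2 = - a.
    by rewrite xE ?inE ?eqxx ?orbT // !mxE !eqxx eq_sym (negPf i12) /= mulr1 mulr0 sub0r.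
  exists x; first by apply/pencilP; rewrite x1 x2 mulrN mulrC subrr.
  by move: i_in; rewrite !inE => /orP[]/eqP->; rewrite ?x1 ?x2 ?oppr_eq0.
have [x xC xE] := free3 i (delta_mx 0 i).
move: i_in; rewrite !inE negb_or ![i == _]eq_sym => /andP[ni1 ni2].
exists x; last by rewrite xE ?mxE ?eqxx ?oner_eq0 // !inE eqxx orbT.
apply/pencilP; split=> //; rewrite !xE ?inE ?eqxx ?orbT // !mxE.
by rewrite (negPf ni1) (negPf ni2) !andbF !mulr0 addr0.
Qed.

Lemma Supp_code : (1 < d)%N -> Supp C = setT.
Proof.
move=> d2; apply/setP=> i; rewrite in_setT; apply/SuppP.
have [|x xC xE] := @small_free [set i] _ (delta_mx 0 i); first by rewrite cards1.
by exists x => //; rewrite xE ?set11 // mxE !eqxx oner_eq0.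
Qed.

(* On the words with equal entries at i1 and i2, the two coordinates impose a single condition;
   this gains one over nonvanishing_word. *)
Lemma full_word_small M : (3 < d)%N -> (#|M| <= #|F|.+1)%N ->
  exists2 x, x \in C & {in M, forall i, x 0 i != 0}.
Proof.
move=> d4 leM; have [/card_gt1P[i1 [i2 [i1M i2M i12]]]|] := ltnP 1 #|M|; last first.
  move=> leM1; apply: nonvanishing_word; last by rewrite Supp_code ?subsetT // ltnW // ltnW.
  by apply: leq_trans leM1 _; rewrite ltnW // finNzRing_gt1.
have [||x /pencilP[xC x12] xJ] := @nonvanishing_word (pencil i1 i2 1 (-1)) (M :\ i2).
- by move: leM; rewrite (cardsD1 i2 M) i2M.
- by rewrite Supp_pencil ?subsetT ?oppr_eq0 ?oner_eq0.
exists x => // i iM; have [->|ii2] := eqVneq i i2; last by rewrite xJ // !inE ii2.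
move/eqP: x12; rewrite mul1r mulN1r subr_eq0 => /eqP <-.
by rewrite xJ // !inE i12.
Qed.

(* The point e lies on the plane of S = {s1, s2, s3}, so the secants s1 s2 and s3 e meet. On the
   words vanishing at the intersection point, each of the two pairs of coordinates becomes
   proportional, leaving only #|M| - 2 conditions. *)
Lemma full_word_hyperoval S e M : #|S| = 3 -> d = 4 -> e \notin S ->
    e \notin Supp (shorten C S) -> S \subset M -> e \in M -> (#|M| <= #|F|.+2)%N ->
  exists2 x, x \in C & {in M, forall i, x 0 i != 0}.
Proof.
move=> cardS d4 eS eZ SM eM leM.
have [y dy ySupp] : exists2 y, in_dual C y & supp y = e |: S.
  by apply: dual_circuit => //; rewrite cardS.
have yn i : i \in e |: S -> y 0 i != 0 by rewrite -ySupp inE.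
have /card_gt2P[s1 [s2 [s3 [[s1S s2S s3S] [s12 s23 s31]]]]] : (2 < #|S|)%N by rewrite cardS.
have SE : S = s1 |: (s2 |: [set s3]).
  apply/esym/eqP; rewrite eqEcard cardS !subUset !sub1set s1S s2S s3S /=.
  by rewrite !cardsU1 !inE cards1 negb_or s12 s23 eq_sym s31.
have es i : i \in S -> i != e by apply: contraTneq => ->.
have yS i : i \in S -> y 0 i != 0 by move=> iS; rewrite yn // setU1r.
(* The coefficients are those of the dual word, so its terms at s1 and s2 cancel and the entries at
   s3 and e become proportional as well. Hence s2 and e can both be dropped from [M]. *)
have [||x /pencilP[xC x12] xJ] :=
  @nonvanishing_word (pencil s1 s2 (y 0 s1) (y 0 s2)) (M :\ s2 :\ e).
- move: leM; rewrite (cardsD1 s2 M) (subsetP SM) // (cardsD1 e (M :\ s2)).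
  by rewrite !inE eM eq_sym es.
- by rewrite Supp_pencil ?subsetT ?yS ?d4.
have xe : x 0 e * y 0 e = - (x 0 s3 * y 0 s3).
  have n1 : s1 \notin s2 |: [set s3] by rewrite !inE negb_or s12 eq_sym.
  have n2 : s2 \notin [set s3] by rewrite !inE.
  rewrite (dual_eval dy ySupp eS xC) SE big_setU1 // big_setU1 // big_set1 /=.
  by rewrite addrA ![_ * y _ _]mulrC x12 add0r.
exists x => // i iM; have [->|ie] := eqVneq i e.
  have : x 0 e * y 0 e != 0.
    rewrite xe oppr_eq0 mulf_neq0 ?yS //; apply: xJ.
    by rewrite !inE (subsetP SM) // es // eq_sym s23.
  by rewrite mulf_eq0 negb_or => /andP[].
have [->|is2] := eqVneq i s2; last by apply: xJ; rewrite !inE ie is2.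
have : y 0 s2 * x 0 s2 != 0.
  move/eqP: x12; rewrite addrC addr_eq0 => /eqP->; rewrite oppr_eq0 mulf_neq0 ?yS //.
  by apply: xJ; rewrite !inE (subsetP SM) // es // s12.
by rewrite mulf_eq0 negb_or => /andP[].
Qed.

(** The complement of the support is the closure of [S]; restriction to it has the same kernel on
    [C], hence the same rank, as restriction to [S]. *)
Lemma shorten_closure S :
  shorten C (~: Supp (shorten C S)) = shorten C S.
Proof.
apply/eqP; rewrite eqEsubv; apply/andP; split; apply/subvP=> x; last first.
  move=> xZ; have /shortenP[xC _] := xZ; apply/shortenP; split=> // i.
  by rewrite in_setC => iZ; apply: shorten_Supp xZ.
case/shortenP=> xC x0; apply/shortenP; split=> // i iS.
by apply: x0; rewrite in_setC notin_Supp_shorten.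
Qed.

Lemma dim_punctured S : free_on C S ->
  \dim (restr (~: Supp (shorten C S)) @: C) = #|S|.
Proof.
move=> freeS; set M := ~: _; apply: (@addnI (\dim (shorten C M))).
by rewrite limg_ker_dim shorten_closure dim_shorten.
Qed.

Lemma wt_restr M x : wt (restr M x) = #|M :&: supp x|.
Proof.
rewrite /wt -(card_imset _ (@enum_val_inj _ (mem M))); congr #|pred_of_set _|.
apply/setP=> i; apply/imsetP/setIP => [[j]|[iM]].
  by rewrite inE restrE => xj ->; rewrite enum_valP inE.
by rewrite inE => xi; exists (enum_rank_in iM i); rewrite ?inE ?restrE enum_rankK_in.
Qed.

Lemma subset_of_card (T : finType) (A : {set T}) m : (m <= #|A|)%N ->
  exists2 B : {set T}, B \subset A & #|B| = m.
Proof.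
case/card_geqP=> s [us sm sA]; exists [set:: s].
  by apply/subsetP=> i; rewrite inE; apply: sA.
by rewrite cardsE; move/card_uniqP: us => ->.
Qed.

(** Let x vanish on a subset T of M with [#|T|] = [#|S|]. T is free, so its shortened code has the
    same dimension as that of M and contains it. They are equal, and x vanishes on all of M. *)
Lemma punctured_MDS S : #|S|.+1 = d -> (0 < #|S|)%N ->
  is_MDS (restr (~: Supp (shorten C S)) @: C)%VS.
Proof.
move=> cardS S0; have freeS : free_on C S by apply: small_free; rewrite -cardS.
rewrite /is_MDS (dim_punctured freeS); set M := ~: _.
have SM : S \subset M.
  by apply/subsetP=> i iS; rewrite in_setC notin_Supp_shorten.
have low x : x \in C -> restr M x != 0 -> (#|M| - #|S| + 1 <= wt (restr M x))%N.
  move=> xC; apply: contraNleq; rewrite wt_restr addn1 ltnS => le_wt.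
  have [T Tsub cardT] : exists2 T : {set 'I_n}, T \subset M :\: supp x & #|T| = #|S|.
    apply: subset_of_card; have := cardsID (supp x) M.
    by have := subset_leq_card SM; lia.
  have [TM Tx] := subsetDP Tsub.
  have freeT : free_on C T by apply: small_free; rewrite cardT -cardS.
  have ZT : shorten C S = shorten C T.
    apply/eqP; rewrite eqEdim; apply/andP; split; last first.
      by rewrite -(leq_add2r #|S|) dim_shorten // -cardT dim_shorten.
    rewrite -shorten_closure; apply/subvP=> z /shortenP[zC z0]; apply/shortenP.
    by split=> // i iT; apply: z0; apply: (subsetP TM).
  have : x \in shorten C S.
    rewrite ZT; apply/shortenP; split=> // i iT.
    by apply/eqP; have := subsetP Tsub i iT; rewrite !inE negbK => /andP[].
  rewrite -shorten_closure => /shortenP[_ x0]; apply/eqP/rowP=> j.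
  by rewrite restrE mxE x0 // enum_valP.
have [i0 i0S] := card_gt0P S0; split; last first.
  by move=> _ /memv_imgP[x xC ->]; apply: low.
(* This word vanishes on [S :\ i0], so its restriction attains the minimum weight. *)
have [x xC xE] := freeS (delta_mx 0 i0).
have xn : restr M x != 0.
  have i0M := subsetP SM _ i0S; apply/eqP=> /rowP/(_ (enum_rank_in i0M i0)).
  by move/eqP; rewrite restrE enum_rankK_in // xE // !mxE !eqxx oner_eq0.
exists (restr M x); split; rewrite ?memv_img //.
apply/eqP; rewrite eqn_leq low // andbT wt_restr.
have sub : M :&: supp x \subset M :\: (S :\ i0).
  apply/subsetP=> i; rewrite !inE => /andP[iM xi]; rewrite iM andbT negb_and negbK.
  have [//|ii0 /=] := eqVneq i i0; apply: contra xi => iS.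
  by rewrite xE // mxE (negPf ii0) andbF.
have := subset_leq_card sub; have := cardsID (S :\ i0) M.
have /setIidPr -> : S :\ i0 \subset M by apply: subset_trans SM; apply: subsetDl.
by rewrite (cardsD1 i0 S) i0S; have := subset_leq_card SM; lia.
Qed.
End MinimumDistance.

(** * Arithmetic in the field with two elements, and nonzero combinations *)

Lemma card2_eq1 (q2 : #|F| = 2) (a : F) : a != 0 -> a = 1.
Proof.
move=> a0; apply/eqP; apply: contraTT (leqnn #|F|) => a1; rewrite {2}q2 -ltnNge.
apply/card_gt2P; exists 0, 1, a; split=> //.
by split; rewrite // eq_sym ?oner_eq0.
Qed.

Lemma card2_char2 : #|F| = 2 -> 1 + 1 = 0 :> F.
Proof.
move=> q2; apply/eqP; apply: contraT => /(card2_eq1 q2)/eqP.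
by rewrite -[X in _ == X]addr0 (inj_eq (addrI 1)) oner_eq0.
Qed.

Lemma odd_char2 m : #|F| = 2 -> odd m -> m%:R = 1 :> F.
Proof.
move=> q2 om; rewrite -[m]odd_double_half om -muln2 natrD natrM.
by rewrite [2%:R](card2_char2 q2) mulr0 addr0.
Qed.

(** The choice v_i = 1 / y_i gives the sum [#|S|%:R]. If this is 0, some t other than 0 and 1
    exists, and multiplying one entry of v by t changes the sum to t - 1. *)
Lemma nonzero_combination S (y : 'rV[F]_n) : (0 < #|S|)%N ->
    {in S, forall i, y 0 i != 0} -> (2 < #|F|)%N || odd #|S| ->
  exists2 v : 'rV[F]_n, {in S, forall i, v 0 i != 0} & \sum_(i in S) v 0 i * y 0 i != 0.
Proof.
move=> /card_gt0P[i0 i0S] yS H.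
have sum1 : \sum_(i in S) (y 0 i)^-1 * y 0 i = #|S|%:R.
  by rewrite -sumr_const; apply: eq_bigr => i iS; rewrite mulVf ?yS.
have [S0|Sn] := eqVneq (#|S|%:R : F) 0; last first.
  exists (\row_i (y 0 i)^-1) => [i iS|]; first by rewrite mxE invr_eq0 yS.
  by under eq_bigr => i _ do rewrite mxE; rewrite sum1.
have q3 : (2 < #|F|)%N.
  case/orP: H => // oS; move: (finNzRing_gt1 F); rewrite leq_eqVlt => /orP[/eqP q2|//].
  by move/eqP: S0; rewrite odd_char2 ?oner_eq0.
have /card_gt0P[t] : (0 < #|~: [set (0%R : F); 1%R]|)%N.
  by rewrite cardsCs setCK subn_gt0 cards2 eq_sym oner_eq0.
rewrite !inE negb_or => /andP[t0 t1].
exists (\row_i ((if i == i0 then t else 1) / y 0 i)) => [i iS|].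
  by rewrite mxE mulf_neq0 ?invr_eq0 ?yS //; case: ifP; rewrite ?oner_eq0.
rewrite (bigD1 i0) //= mxE eqxx mulfVK ?yS //.
move: sum1; rewrite (bigD1 i0) //= S0 mulVf ?yS // => /eqP.
rewrite addrC addr_eq0 => /eqP sum1.
rewrite (eq_bigr (fun i => (y 0 i)^-1 * y 0 i)) ?sum1 ?subr_eq0 // => i /andP[_ ii0].
by rewrite mxE (negPf ii0) mul1r.
Qed.
End Shortening.

(** * Words without zeros on a closure, and covering subcodes *)

Section CoveringDimension.
Local Open Scope ring_scope.
Variables (F : finFieldType) (n : nat).
Implicit Types (C D : {vspace 'rV[F]_n}) (S : {set 'I_n}).

Lemma full_word_closure (HMDS : MDS_conjecture) C (d : nat) S :
    (forall y, in_dual C y -> y != 0 -> (d <= wt y)%N) ->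
    #|S|.+1 = d -> (3 < d)%N -> d <> #|F| ->
    (2 < #|F|)%N || odd #|S| \/ ~: Supp (shorten C S) = S ->
  exists2 x, x \in C & forall i, i \notin Supp (shorten C S) -> x 0 i != 0.
Proof.
move=> dual_wt cardS d4 dq small; pose M := ~: Supp (shorten C S).
suff [x xC xM] : exists2 x, x \in C & {in M, forall i, x 0 i != 0}.
  by exists x => // i iZ; apply: xM; rewrite in_setC.
have freeS : free_on C S by apply: (small_free dual_wt); rewrite -cardS.
have SM : S \subset M.
  by apply/subsetP=> i iS; rewrite in_setC notin_Supp_shorten.
have [leM|gtM] := leqP #|M| #|F|.+1; first exact: (full_word_small dual_wt).
have [MS|/eqP MS] := eqVneq M S.
  have [x xC xE] := freeS (const_mx 1); exists x => // i.
  by rewrite MS => iS; rewrite xE // mxE oner_eq0.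
have /properP[_ [e eM eS]] : S \proper M by rewrite properEneq SM eq_sym andbT; apply/eqP.
have eZ : e \notin Supp (shorten C S) by rewrite -in_setC.
have [y dy ySupp] := dual_circuit dual_wt cardS eS eZ.
have yn i : i \in e |: S -> y 0 i != 0 by rewrite -ySupp inE.
have eSM : e |: S \subset M by rewrite subUset sub1set eM.
have [leM2|gtM2] := leqP #|M| #|S|.+1.
  have ME : M = e |: S.
    by apply/eqP; rewrite eq_sym eqEcard eSM cardsU1 eS.
  (* The dual word determines the entry at e from those on [S]; v is chosen to make it nonzero. *)
  have [|||v vS vy] := @nonzero_combination F n S y.
  - by lia.
  - by move=> i iS; rewrite yn // setU1r.
  - by case: small.
  have [x xC xE] := freeS v; exists x => // i; rewrite ME !inE => /orP[/eqP->|iS].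
    have : x 0 e * y 0 e != 0.
      rewrite (dual_eval dy ySupp eS xC) oppr_eq0 (eq_bigr (fun i => v 0 i * y 0 i)) //.
      by move=> j jS; rewrite xE.
    by rewrite mulf_eq0 negb_or => /andP[].
  by rewrite xE ?vS.
have S0 : (0 < #|S|)%N by lia.
have H1 : (2 <= #|S| <= #|M| - 2)%N.
  by lia.
have := HMDS F _ _ _ (dim_punctured freeS) H1 (punctured_MDS dual_wt cardS S0).
(* Outside the exceptional dimensions the bound contradicts [#|M|] > q + 1. Dimension 3 means d = 4,
   and dimension q - 1 would mean d = q. *)
rewrite -/M; case: ifP => [/andP[_ /orP[/eqP S3|/eqP Sq]]|_] leM; last by lia.
- have d4' : d = 4 by rewrite -cardS S3.
  rewrite addn2 in leM.
  exact: (full_word_hyperoval dual_wt S3 d4' eS eZ SM eM leM).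
- by case: dq; have := finNzRing_gt1 F; lia.
Qed.

Lemma dim_ge_dual_wt C (d : nat) S :
    (forall y, in_dual C y -> y != 0 -> (d <= wt y)%N) ->
  (#|S| < d)%N -> (#|S| <= \dim C)%N.
Proof. by move=> H /(small_free H)/dim_shorten <-; apply: leq_addl. Qed.

(** Adding one point to a set of size d - 2 keeps it free, so such a set is its own closure and a
    word equal to 1 on it can serve as x. *)
Lemma covering_bound C (d : nat) :
    (forall y, in_dual C y -> y != 0 -> (d <= wt y)%N) -> (3 <= d <= n)%N ->
  exists D : {vspace 'rV[F]_n},
    [/\ (D <= C)%VS, (\dim D + d = \dim C + 3)%N & Supp D = setT].
Proof.
move=> dual_wt /andP[d3 dn].
have [|S _ cardS] := @subset_of_card _ [set: 'I_n] (d - 2).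
  by rewrite cardsT card_ord; lia.
have freeS : free_on C S by apply: (small_free dual_wt); lia.
have [x xC xE] := freeS (const_mx 1).
have [|i|D [DC dimD DT]] := full_extension freeS _ xC; first by lia.
  move=> iZ; have [iS|iS] := boolP (i \in S); first by rewrite xE // mxE oner_eq0.
  have [|z zC zE] := @small_free _ _ C d dual_wt (i |: S) _ (delta_mx 0 i).
    by rewrite cardsU1 iS; lia.
  case/SuppP: iZ; exists z; last by rewrite zE ?setU11 // mxE !eqxx oner_eq0.
  apply/shortenP; split=> // j jS; rewrite zE ?setU1r // mxE.
  by rewrite (_ : (j == i) = false) ?andbF //; apply: contraNF iS => /eqP <-.
by exists D; split=> //; lia.
Qed.

Lemma full_dim_gt0 D : (0 < n)%N -> Supp D = setT -> (0 < \dim D)%N.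
Proof.
move=> n0 DT; rewrite lt0n dimv_eq0; apply/eqP=> D0.
have : Ordinal n0 \in Supp D by rewrite DT inE.
by rewrite D0 => /SuppP[x]; rewrite memv0 => /eqP->; rewrite mxE eqxx.
Qed.

(** Descent on the dimension; whether a smaller covering subcode exists is decided classically. *)
Lemma covdim_exists C D : (0 < n)%N -> (D <= C)%VS -> Supp D = setT ->
  exists r, covdim_is C r /\ (r <= \dim D)%N.
Proof.
move=> n0; have [m] := ubnP (\dim D); elim: m D => // m IH D ltDm DC DT.
have [[D' [D'C D'T ltD']]|min] := classic (exists D' : {vspace 'rV[F]_n},
    [/\ (D' <= C)%VS, Supp D' = setT & (\dim D' < \dim D)%N]).
  have [|r [rC rD']] := IH D' _ D'C D'T; first exact: leq_trans ltD' _.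
  by exists r; split=> //; apply: leq_trans rD' (ltnW ltD').
exists (\dim D); split=> //; split; first 1 last.
- exact: full_dim_gt0.
- by exists D.
- move=> D' D'C _ D'T; rewrite leqNgt; apply/negP=> lt; apply: min.
  by exists D'.
apply/setP=> i; rewrite in_setT; have /SuppP[x xD xi] : i \in Supp D by rewrite DT inE.
by apply/SuppP; exists x => //; apply: subvP xD.
Qed.

(** * Generator matrices and dual Hamming codes *)

Lemma mem_generator C : exists G : 'M[F]_(\dim C, n),
  forall y, y \in C <-> exists u : 'rV[F]_(\dim C), y = u *m G.
Proof.
exists (\matrix_(i < \dim C) (vbasis C)`_i) => y; split=> [yC|[u ->]].
  exists (\row_i coord (vbasis C) i y); rewrite {1}(coord_vbasis yC) mulmx_sum_row.
  by apply: eq_bigr => i _; rewrite rowK mxE.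
rewrite mulmx_sum_row memv_suml // => i _; rewrite rowK memvZ // vbasis_mem //.
by rewrite mem_nth // size_tuple.
Qed.

Lemma mulmx_colE k (G : 'M[F]_(k, n)) (u : 'rV_k) j :
  (u *m col j G) 0 0 = (u *m G) 0 j.
Proof. by rewrite colE mulmxA -colE [LHS]mxE. Qed.

Lemma mulmx_col_scale k (G : 'M[F]_(k, n)) (u : 'rV_k) (v : 'cV_k) j c :
  col j G = c *: v -> (u *m G) 0 j = c * (u *m v) 0 0.
Proof.
by move=> GE; rewrite -mulmx_colE GE -scalemxAr mxE.
Qed.

(** If [D] is proper, its messages lie in a hyperplane orthogonal to some z. The point z is, up to a
    scalar, a column j, and every word of [D] vanishes at j. *)
Lemma dual_hamming_full_dim C D : dual_hamming C -> (D <= C)%VS ->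
  Supp D = setT -> (\dim C <= \dim D)%N.
Proof.
case=> k [G [_ _ GC _ Gpts]] DC DT; pose f : 'Hom('rV[F]_k, 'rV[F]_n) := linfun (mulmxr G).
have [full|nfull] := eqVneq (f @^-1: D)%VS fullv.
  apply/dimvS/subvP=> x /GC[u ->]; have : u \in (f @^-1: D)%VS by rewrite full memvf.
  by rewrite -memv_preim lfunE.
have [z z0 dz] : exists2 z, z != 0 & in_dual (f @^-1: D)%VS z.
  apply: dim_lt_dual; rewrite ltn_neqAle; apply/andP; split; last first.
    by rewrite -[leqRHS](dim_rV F k) dimvS ?subvf.
  by apply: contra nfull => /eqP dimE; rewrite eqEdim subvf dim_rV dimE /=.
have zT0 : z^T != 0 by rewrite trmx_eq0.
have [j [[c Gj] _]] := Gpts _ zT0.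
have /SuppP[x xD + ] : j \in Supp D by rewrite DT inE.
have [u xE] := (GC x).1 (subvP DC x xD); rewrite xE (mulmx_col_scale u Gj).
rewrite (_ : (u *m z^T) 0 0 = dotp u z); last first.
  by rewrite mxE; apply: eq_bigr => i _; rewrite mxE.
by rewrite dz ?mulr0 ?eqxx // -memv_preim lfunE /= -xE.
Qed.

(** Permuting the columns of the generator matrix back and dividing them by the scalars keeps one
    vector per point. *)
Lemma mon_equiv_dual_hamming C D : mon_equiv C D -> dual_hamming D -> dual_hamming C.
Proof.
move=> [s [a [a0 CD]]] [k [G [nE dimD GD Gn Gpts]]].
have monE x i : (monomial_map s a x) 0 i = a i * x 0 (s i) by rewrite mxE.
pose b j := (a ((s^-1)%g j))^-1.
have b0 j : b j != 0 by rewrite invr_eq0.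
pose G' := \matrix_(i, j) (b j * G i ((s^-1)%g j)).
have colG' j : col j G' = b j *: col ((s^-1)%g j) G.
  by apply/colP=> i; rewrite !mxE.
have mulG' u : monomial_map s a (u *m G') = u *m G.
  apply/rowP=> i; rewrite monE !mxE mulr_sumr; apply: eq_bigr => l _.
  by rewrite !mxE /b permK mulrCA mulVKf.
have mon_inj : injective (monomial_map s a).
  move=> x y /rowP xy; apply/rowP=> j; have := xy ((s^-1)%g j).
  by rewrite !monE permKV; apply: mulfI.
exists k, G'; split=> //.
(* The monomial map is linear and injective, so it preserves the dimension. *)
- pose N := \matrix_(j, i) (if j == s i then a i else 0).
  have NE x : x *m N = monomial_map s a x.
    apply/rowP=> i; rewrite monE mxE (bigD1 (s i)) //= mxE eqxx mulrC big1 ?addr0 //.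
    by move=> j /negPf ji; rewrite mxE ji mulr0.
  rewrite -dimD; have -> : D = (linfun (mulmxr N) @: C)%VS.
    apply/vspaceP=> y; apply/idP/memv_imgP => [/CD[x xC ->]|[x xC ->]].
      by exists x; rewrite // lfunE /= NE.
    by rewrite lfunE /= NE; apply/CD; exists x.
  rewrite limg_dim_eq //; apply/eqP; rewrite -subv0; apply/subvP=> x.
  rewrite memv_cap memv_ker lfunE /= NE memv0 => /andP[_ /eqP x0].
  apply/eqP; apply: mon_inj; rewrite x0; apply/rowP=> i.
  by rewrite monE !mxE mulr0.
- move=> y; split=> [yC|[u ->]].
    have /GD[u yE] : monomial_map s a y \in D by apply/CD; exists y.
    by exists u; apply: mon_inj; rewrite mulG'.
  have /CD[x xC xE] : u *m G \in D by apply/GD; exists u.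
  by rewrite (_ : u *m G' = x) //; apply: mon_inj; rewrite mulG'.
- by move=> j; rewrite colG' scaler_eq0 negb_or b0 Gn.
move=> v v0; have [j [[c Gj] uniqj]] := Gpts v v0; exists (s j); split.
  by exists (b (s j) * c); rewrite colG' permK Gj scalerA.
move=> j' [c' Gj']; rewrite -(uniqj ((s^-1)%g j')) ?permKV //.
exists ((b j')^-1 * c'); rewrite -scalerA -Gj' colG' scalerA mulVf // scale1r //.
Qed.

Lemma mon_equiv_refl C : mon_equiv C C.
Proof.
exists 1%g, (fun=> 1); split=> [i|y]; first exact: oner_neq0.
have E x : monomial_map 1%g (fun=> 1) x = x :> 'rV[F]_n.
  by apply/rowP=> i; rewrite mxE perm1 mul1r.
by split=> [yC|[x xC ->]]; [exists y | rewrite E].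
Qed.

(** * Columns as points of projective space *)

Section GeneratorColumns.
Variables (C : {vspace 'rV[F]_n}) (k : nat) (G : 'M[F]_(k, n)).
Hypothesis dual_wt : forall y, in_dual C y -> y != 0 -> (3 <= wt y)%N.
Hypothesis genG : forall y, y \in C <-> exists u : 'rV[F]_k, y = u *m G.

Lemma generator_col_neq0 j : col j G != 0.
Proof.
have /SuppP[x /genG[u ->]] : j \in Supp C by rewrite (Supp_code dual_wt) // inE.
apply: contraNneq => Gj.
by rewrite (mulmx_col_scale u (v := 0) (c := 0)) ?mul0r // Gj scaler0.
Qed.

(** Two coordinates are free, so some word is 1 at j and 0 at j'; this rules out a column j
    proportional to column j'. *)
Lemma generator_col_inj j j' c : col j G = c *: col j' G -> j = j'.
Proof.
move=> Gj; apply/eqP; have [//|jj'] := eqVneq j j'.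
have [|x /genG[u ->] xE] := @small_free _ _ C 3 dual_wt [set j; j'] _ (delta_mx 0 j).
  by rewrite cards2; case: (_ != _).
have := xE j (set21 _ _); rewrite (mulmx_col_scale u Gj).
rewrite mulmx_colE xE ?set22 // !mxE !eqxx [j' == j]eq_sym (negPf jj') mulr0 => /eqP.
by rewrite eq_sym oner_eq0.
Qed.

(** Uniqueness comes from [generator_col_inj]. The length is found by counting: the pairs (j, c)
    with c nonzero correspond to the nonzero vectors, so n (q - 1) = q^k - 1. *)
Lemma dual_hammingI : \dim C = k ->
  (forall v : 'cV[F]_k, v != 0 -> exists j c, col j G = c *: v) -> dual_hamming C.
Proof.
move=> dimC Gpts; exists k, G; split=> //; last 2 first.
- exact: generator_col_neq0.
- move=> v v0; have [j [c Gj]] := Gpts v v0; exists j; split; first by exists c.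
  move=> j' [c' Gj']; apply: (@generator_col_inj j' j (c' / c)).
  rewrite Gj' Gj scalerA mulfVK //.
  by apply: contraNneq (generator_col_neq0 j) => c0; rewrite Gj c0 scale0r.
pose A := setX [set: 'I_n] [set~ (0%R : F)].
pose f (p : 'I_n * F) := p.2 *: col p.1 G.
have finj : {in A &, injective f}.
  move=> [j c] [j' c']; rewrite !inE /f /= => c0 c0' E.
  have jj' : j = j'.
    by apply: (@generator_col_inj j j' (c^-1 * c')); rewrite -scalerA -E scalerK.
  rewrite jj' in E *; congr (_, _); apply/eqP; move/eqP: E.
  by rewrite -subr_eq0 -scalerBl scaler_eq0 (negPf (generator_col_neq0 j')) orbF subr_eq0.
have fA : f @: A = [set~ 0].
  apply/setP=> v; rewrite !inE; apply/imsetP/idP => [[[j c]]|v0].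
    by rewrite !inE /= => c0 ->; rewrite scaler_eq0 negb_or c0 generator_col_neq0.
  have [j [c Gj]] := Gpts v v0.
  have c0 : c != 0.
    by apply: contraNneq (generator_col_neq0 j) => c0; rewrite Gj c0 scale0r.
  by exists (j, c^-1); rewrite ?inE /f /= ?invr_eq0 // Gj scalerK.
have := card_in_imset finj; rewrite fA cardsX !cardsC1 cardsT card_ord card_mx muln1.
by rewrite !subn1 => ->; rewrite mulnK // -ltnS prednK ?finNzRing_gt1 // ltnW // finNzRing_gt1.
Qed.

End GeneratorColumns.

(** Some point v is not a column. The messages orthogonal to v give [D]: if all its words vanished
    at i, column i would be a multiple of v. *)
Lemma proper_covering C : (forall y, in_dual C y -> y != 0 -> (3 <= wt y)%N) ->
    ~ dual_hamming C ->
  exists D : {vspace 'rV[F]_n}, [/\ (D <= C)%VS, (\dim D < \dim C)%N & Supp D = setT].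
Proof.
move=> dual_wt nH; have [G genG] := mem_generator C.
have [/forallP Gpts|] := boolP [forall v : 'cV[F]_(\dim C),
    (v != 0) ==> [exists j, [exists c : F, col j G == c *: v]]].
  case: nH; apply: (dual_hammingI dual_wt genG) => // v v0.
  have /existsP[j /existsP[c /eqP Gj]] := implyP (Gpts v) v0.
  by exists j, c.
rewrite negb_forall => /existsP[v]; rewrite negb_imply => /andP[v0 vpt].
pose D := (linfun (mulmxr G) @: annih fullv v^T)%VS.
have dotv (u : 'rV_(\dim C)) : dotp u v^T = (u *m v) 0 0.
  by rewrite mxE; apply: eq_bigr => i _; rewrite mxE.
exists D; split.
- by apply/subvP=> x /memv_imgP[u _ ->]; apply/genG; exists u; rewrite lfunE.
- have : (\dim D <= \dim (annih fullv v^T))%N.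
    by rewrite -(limg_ker_dim (linfun (mulmxr G)) (annih _ _)) leq_addl.
  move/leq_ltn_trans; apply; rewrite -[ltnRHS](dim_rV F) ltn_neqAle dimvS ?subvf // andbT.
  apply: contra v0 => /eqP dimE; have full : annih fullv v^T = fullv.
    by apply/eqP; rewrite eqEdim subvf dimE /=.
  apply/eqP/colP=> i; rewrite mxE.
  have /annihP[_] : delta_mx 0 i \in annih fullv v^T by rewrite full memvf.
  by rewrite dotp_delta mxE.
apply/setP=> i; rewrite in_setT; apply/negPn; apply: contra vpt => iD.
have D0 (u : 'rV[F]_(\dim C)) : (u *m v) 0 0 = 0 -> (u *m G) 0 i = 0.
  move=> uv; apply: contraNeq iD => ui; apply/SuppP; exists (u *m G) => //.
  apply/memv_imgP; exists u; last by rewrite lfunE.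
  by apply/annihP; rewrite memvf dotv.
have [l vl] : exists l, v l 0 != 0.
  by apply/existsP; apply: contraR v0; rewrite negb_exists => /forallP v0;
    apply/eqP/colP=> l; rewrite mxE; apply/eqP/negPn.
apply/existsP; exists i; apply/existsP; exists (G l i / v l 0); apply/eqP/colP=> m.
(* This message is orthogonal to v, which yields v_l G_mi = v_m G_li for every m. *)
have := D0 (v l 0 *: delta_mx 0 m - v m 0 *: delta_mx 0 l).
rewrite !mulmxBl -!scalemxAl -!rowE !mxE [v m 0 * _]mulrC subrr => /(_ erefl)/eqP.
rewrite subr_eq0 => /eqP E; rewrite [G l i / _]mulrC -mulrA [G l i * _]mulrC -E mulKf //.
Qed.

(** * The binary case with d odd *)

Lemma binary_odd_full_dim C D y : #|F| = 2 -> odd n -> in_dual C y -> wt y = n ->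
  (D <= C)%VS -> Supp D = setT -> (1 < \dim D)%N.
Proof.
move=> q2 on dy wty DC DT; rewrite ltnNge; apply/negP=> dim1.
have n0 : (0 < n)%N by apply: odd_gt0.
have /SuppP[x xD x0i] : Ordinal n0 \in Supp D by rewrite DT inE.
have x0 : x != 0 by apply: contraNneq x0i => ->; rewrite mxE.
have DE : <[x]>%VS = D.
  by apply/eqP; rewrite eqEdim -memvE xD dim_vline x0.
have xn i : x 0 i != 0.
  have /SuppP[z] : i \in Supp D by rewrite DT inE.
  rewrite -DE => /vlineP[c ->]; rewrite mxE.
  by apply: contraNneq => ->; rewrite mulr0.
have yn i : y 0 i != 0.
  have suppT : supp y = setT.
    by apply/eqP; rewrite eqEcard subsetT cardsT card_ord -[#|supp y|]/(wt y) wty leqnn.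
  by have := in_setT i; rewrite -suppT inE.
(* Both words are all ones, so their product is n in F, which is 1 for odd n. *)
have /eqP := dy x (subvP DC x xD); rewrite /dotp (eq_bigr (fun=> 1)) => [|i _].
  by rewrite sumr_const card_ord odd_char2 // oner_eq0.
by rewrite (card2_eq1 q2 (xn i)) (card2_eq1 q2 (yn i)) mulr1.
Qed.

(* Two distinct minimum weight dual words cannot meet in d - 2 positions, as their sum would have
   weight at most 4. So S consists of d - 2 points of supp y and one point outside. *)
Lemma binary_closed_set C (d : nat) y : #|F| = 2 ->
    (forall z, in_dual C z -> z != 0 -> (d <= wt z)%N) ->
    in_dual C y -> wt y = d -> (4 < d)%N -> (d < n)%N ->
  exists2 S : {set 'I_n}, #|S|.+1 = d & ~: Supp (shorten C S) = S.
Proof.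
move=> q2 dual_wt dy wty d5 ltdn.
have [a ay] : exists a, a \notin supp y.
  apply/existsP; apply: contraLR ltdn; rewrite negb_exists => /forallP ally.
  rewrite -leqNgt -wty -[X in (X <= _)%N]card_ord -cardsT; apply/subset_leq_card/subsetP.
  by move=> i _; apply/negPn.
have [|B By cardB] := @subset_of_card _ (supp y) (d - 2); first by rewrite -/(wt y) wty; lia.
have aB : a \notin B by apply: contra ay; apply: subsetP.
have cardS : #|a |: B|.+1 = d by rewrite cardsU1 aB cardB; lia.
exists (a |: B) => //; apply/eqP; rewrite eqEsubset andbC; apply/andP; split.
  by apply/subsetP=> i iS; rewrite in_setC notin_Supp_shorten.
apply/subsetP=> e; rewrite in_setC => eZ; apply/negPn/negP => eS.
have [z dz zsupp] := dual_circuit dual_wt cardS eS eZ.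
have zn i : (z 0 i != 0) = (i \in e |: (a |: B)) by rewrite -zsupp inE.
have dw : in_dual C (y + z).
  by move=> x xC; rewrite dotpC dotpDl dotpC dy // dotpC dz ?addr0.
(* On [B] both words equal 1 and cancel; besides e and a, only the two points of [supp y] outside
   [B] remain. *)
have wsub : supp (y + z) \subset e |: (a |: supp y :\: B).
  apply/subsetP=> i; rewrite inE mxE; apply: contraR => iout.
  have [iB|iB] := boolP (i \in B).
    have yi : y 0 i != 0 by have := subsetP By i iB; rewrite inE.
    have zi : z 0 i != 0 by rewrite zn !inE iB !orbT.
    by rewrite (card2_eq1 q2 yi) (card2_eq1 q2 zi) card2_char2.
  move: iout; rewrite !inE iB /= !negb_or negbK => /and3P[ie ia /eqP ->].
  by rewrite add0r -[_ == _]negbK zn !inE (negPf ie) (negPf ia) (negPf iB).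
have w0 : y + z != 0.
  apply/eqP => /rowP/(_ a)/eqP; rewrite !mxE; move: ay; rewrite inE negbK => /eqP->.
  by rewrite add0r; apply/negP; rewrite zn !inE eqxx orbT.
have := dual_wt _ dw w0; have := subset_leq_card wsub; rewrite -/(wt (y + z)).
have := cardsU1 e (a |: supp y :\: B); have := cardsU1 a (supp y :\: B).
have := cardsDS By; rewrite -[#|supp y|]/(wt y) wty cardB.
by case: (e \notin _); case: (a \notin _); lia.
Qed.

End CoveringDimension.

(** * Assembly of the cases *)

Theorem mainTheorem13 (HMDS : MDS_conjecture) (F : finFieldType) (n : nat)
    (C : {vspace 'rV[F]_n}) (d : nat) :
  (exists y, in_dual C y /\ (y != 0)%R) ->
  minwt_is (in_dual C) d ->
  (3 <= d)%N -> d <> #|F| ->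
  let k := \dim C in
  ((exists D : {vspace 'rV[F]_n}, dual_hamming D /\ mon_equiv C D) \/
     [/\ #|F| = 2, k = (n - 1)%N, d = n & odd n] ->
   covdim_is C (k + 3 - d)%N) /\
  (~ ((exists D : {vspace 'rV[F]_n}, dual_hamming D /\ mon_equiv C D) \/
     [/\ #|F| = 2, k = (n - 1)%N, d = n & odd n]) ->
   exists r, covdim_is C r /\ (r <= k + 2 - d)%N).
Proof.
move=> _ [[y [dy y0 wty]] dual_wt] d3 dq k.
have dn : (d <= n)%N by rewrite -wty /wt -[leqRHS]card_ord max_card.
have n0 : (0 < n)%N by lia.
have ltkn : (k < n)%N.
  rewrite /k -[ltnRHS](dim_rV F) ltn_neqAle dimvS ?subvf // andbT.
  apply: contra y0 => /eqP dimE; have full : C = fullv.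
    by apply/eqP; rewrite eqEdim subvf dimE /=.
  apply/eqP/rowP=> i; rewrite mxE -dotp_delta; apply: dy.
  by rewrite full memvf.
have CT : Supp C = setT by apply: (Supp_code dual_wt); lia.
have lekd (S : {set 'I_n}) : (#|S| < d)%N -> (#|S| <= k)%N.
  exact: (dim_ge_dual_wt dual_wt).
(* A set of d - 1 coordinates is free. The truncated subtractions in the conclusion are therefore
   genuine. *)
have ledk : (d <= k.+1)%N.
  have [|S _ cardS] := @subset_of_card _ [set: 'I_n] (d - 1).
    by rewrite cardsT card_ord; lia.
  by have := lekd S; lia.
have dn3 : (3 <= d <= n)%N by rewrite d3.
have [D0 [D0C dimD0 D0T]] := covering_bound dual_wt dn3.
split.
  case=> [[D [HD CD]]|[q2 kE dE on]].
    have hamC := mon_equiv_dual_hamming CD HD.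
    (* Comparison with the general bound forces d = 3, so the claimed value is k. *)
    have := dual_hamming_full_dim hamC D0C D0T; rewrite -/k => lek.
    have -> : (k + 3 - d)%N = k by lia.
    split=> //; first by lia.
      by exists C.
    by move=> D' D'C _ D'T; apply: dual_hamming_full_dim hamC D'C D'T.
  have -> : (k + 3 - d)%N = 2 by lia.
  split=> //; first by exists D0; split=> //; lia.
  move=> D DC dim0 DT; apply: (binary_odd_full_dim q2 on dy _ DC DT).
  by rewrite wty.
move=> nexc.
suff [D [DC leD DT]] : exists D : {vspace 'rV[F]_n},
    [/\ (D <= C)%VS, (\dim D <= k + 2 - d)%N & Supp D = setT].
  have [r [rC rD]] := covdim_exists n0 DC DT.
  by exists r; split=> //; apply: leq_trans leD.
have nham : ~ dual_hamming C.
  by move=> hamC; apply: nexc; left; exists C; split=> //; apply: mon_equiv_refl.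
have [d4|d4] := ltnP 3 d; last first.
  have d3E : d = 3 by lia.
  rewrite d3E in dual_wt; have [D [DC ltD DT]] := proper_covering dual_wt nham.
  by exists D; split=> //; rewrite -/k in ltD; lia.
suff [S cardS HS] : exists2 S : {set 'I_n}, #|S|.+1 = d &
    (2 < #|F|)%N || odd #|S| \/ ~: Supp (shorten C S) = S.
  have [x xC xfull] := full_word_closure HMDS dual_wt cardS d4 dq HS.
  have freeS : free_on C S by apply: (small_free dual_wt); lia.
  have [|D [DC dimD DT]] := full_extension freeS _ xC xfull; first by lia.
  by exists D; split=> //; rewrite -/k in dimD; lia.
have [q3|q3] := ltnP 2 #|F|.
  have [|S _ cardS] := @subset_of_card _ [set: 'I_n] (d - 1).
    by rewrite cardsT card_ord; lia.
  by exists S; [lia|left].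
have q2 : #|F| = 2 by apply/eqP; rewrite eqn_leq q3 finNzRing_gt1.
(* For even d the set has odd size d - 1, as [nonzero_combination] requires when q = 2. *)
have [dodd|deven] := boolP (odd d); last first.
  have [|S _ cardS] := @subset_of_card _ [set: 'I_n] (d - 1).
    by rewrite cardsT card_ord; lia.
  exists S; first by lia.
  by left; apply/orP; right; lia.
have d5 : (4 < d)%N by rewrite ltn_neqAle d4 andbT; apply: contraTneq dodd => <-.
(* If d = n, then d - 1 <= k < n gives k = n - 1, which is the excluded binary exception. *)
have ltdn : (d < n)%N.
  rewrite ltn_neqAle dn andbT; apply/eqP => dE; apply: nexc; right.
  by split=> //; [rewrite -/k; lia | rewrite -dE].
have [S cardS HS] := binary_closed_set q2 dual_wt dy wty d5 ltdn.
by exists S; [|right].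
Qed.
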